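(* Let $\mathfrak{q}$ and $\mathfrak{q}'$ be $n\times n$ and $n'\times n'$ quantum parameter matrices over a field $k$ that are multiplicatively independent, and let $V,V'$ be $k$-vector spaces with bases $v_1,\dots,v_n$ and $w_1,\dots,w_{n'}$. Then $\mathrm{Stab}(\mathfrak{q}\otimes\mathfrak{q}')\cong\mathrm{Stab}(\mathfrak{q})\times\mathrm{Stab}(\mathfrak{q}')$ and $$\mathrm{Aut}_{\mathrm{gr}}(S_{\mathfrak{q}\otimes\mathfrak{q}'}(V\otimes V'))\ \cong\ \Big(\prod_{B\in\mathcal{B}_{\mathfrak{q}},\,B'\in\mathcal{B}_{\mathfrak{q}'}}\mathrm{GL}(V_B\otimes V'_{B'})\Big)\rtimes\big(\mathrm{Stab}(\mathfrak{q})\times\mathrm{Stab}(\mathfrak{q}')\big).$$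
   Context: A quantum parameter matrix is a square matrix $\mathfrak{p}=(p_{ij})$ over $k$ with $p_{ii}=1$ and $p_{ij}p_{ji}=1$. For such $\mathfrak{p}$ of size $m$ and a vector space $U$ with basis $u_1,\dots,u_m$, $S_{\mathfrak{p}}(U)$ is the $k$-algebra generated by $u_1,\dots,u_m$ with relations $u_ju_i=p_{ij}u_iu_j$, graded by $\deg u_i=1$; $\mathrm{Aut}_{\mathrm{gr}}$ is its group of degree-preserving algebra automorphisms, viewed as a subgroup of $\mathrm{GL}(U)$. $\mathcal{B}_{\mathfrak{p}}$ is the partition of the index set with $i\sim j$ iff rows $i,j$ of $\mathfrak{p}$ are identical (its classes are the blocks); $\mathfrak{p}_{BC}=(p_{ij})_{i\in B,j\in C}$; with $r$ the number of blocks, $\mathfrak{S}_r$ permutes the blocks and $\mathrm{Stab}(\mathfrak{p})=\{\sigma\in\mathfrak{S}_r:|\sigma(B)|=|B|\text{ and }\mathfrak{p}_{BC}=\mathfrak{p}_{\sigma(B)\sigma(C)}\text{ for all blocks }B,C\}$. For an index subset $B$, $U_B=\mathrm{span}\{u_i:i\in B\}$, and $\mathrm{GL}(U_B)$ is identified with the subgroup of $\mathrm{GL}(U)$ acting on $U_B$ and fixing the other basis vectors. The Kronecker product $\mathfrak{q}\otimes\mathfrak{q}'$ has rows and columns indexed by $[n]\times[n']$ with entries $(\mathfrak{q}\otimes\mathfrak{q}')_{(i,i'),(j,j')}=q_{ij}q'_{i'j'}$; $S_{\mathfrak{q}\otimes\mathfrak{q}'}(V\otimes V')$ uses the basis $v_i\otimes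 w_{i'}$ indexed by $(i,i')$, so it has relations $(v_j\otimes w_m)(v_i\otimes w_\ell)=q_{ij}q'_{\ell m}(v_i\otimes w_\ell)(v_j\otimes w_m)$. $\mathfrak{q}$ and $\mathfrak{q}'$ are multiplicatively independent when $\{ab:a,b\text{ entries of }\mathfrak{q}\}\cap\{cd:c,d\text{ entries of }\mathfrak{q}'\}=\{1\}$. *)

(* Defs.v *)
From HB Require Import structures.
From mathcomp Require Import all_boot all_order all_fingroup all_algebra.
Set Implicit Arguments. Unset Strict Implicit. Unset Printing Implicit Defensive.
Import GRing.Theory.
Local Open Scope ring_scope.

Section QPM.
Variable k : fieldType.

Definition qpm (m : nat) (p : 'M[k]_m) : Prop :=
  (forall i, p i i = 1) /\ (forall i j, p i j * p j i = 1).

Definition blocks (m : nat) (p : 'M[k]_m) : {set {set 'I_m}} :=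
  [set [set j | row j p == row i p] | i : 'I_m].

Definition blk (m : nat) (p : 'M[k]_m) := {B : {set 'I_m} | B \in blocks p}.

(* Stab(p) inside the symmetric group on the set of blocks.  The condition
   p_BC = p_{s(B) s(C)} is read entrywise (the blocks p_BC are constant). *)
Definition Stab (m : nat) (p : 'M[k]_m) : {set {perm blk p}} :=
  [set s : {perm blk p} |
     [forall B : blk p, #|val (s B)| == #|val B| ] &&
     [forall B : blk p, forall C : blk p, forall i : 'I_m, forall j : 'I_m,
      forall i' : 'I_m, forall j' : 'I_m,
        [&& i \in val B, j \in val C, i' \in val (s B) & j' \in val (s C)]
          ==> (p i j == p i' j')]].

(* the index (i,i') of the basis vector v_i (x) w_i' of V (x) V' is encoded
   as mxvec_index i i' : 'I_(n*n'); kidx is its inverse *)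
Definition kidx (n n' : nat) (a : 'I_(n * n')) : 'I_n * 'I_n' :=
  enum_val (cast_ord (esym (mxvec_cast n n')) a).

Definition qkron (n n' : nat) (q : 'M[k]_n) (q' : 'M[k]_n') : 'M[k]_(n * n') :=
  \matrix_(a, b) (q (kidx a).1 (kidx b).1 * q' (kidx a).2 (kidx b).2).

Definition mult_indep (n n' : nat) (q : 'M[k]_n) (q' : 'M[k]_n') : Prop :=
  forall x : k,
    ((exists i j l m, x = q i j * q l m) /\
     (exists i j l m, x = q' i j * q' l m)) <-> x = 1.

(* S_p(U) is the quadratic algebra T(U)/(R_p).  Degree 2 of T(U) is U (x) U,
   identified with 'M_m via u_a (x) u_b |-> delta_mx a b (so that
   (g (x) g)(X) = g^T X g for g acting on row vectors, u_a |-> row a g).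
   R_p is spanned by u_j (x) u_i - p_ij u_i (x) u_j. *)
Definition relel (m : nat) (p : 'M[k]_m) (i j : 'I_m) : 'M[k]_m :=
  delta_mx j i - p i j *: delta_mx i j.

Definition relspace (m : nat) (p : 'M[k]_m) : 'M[k]_(m * m) :=
  (\sum_(i < m) \sum_(j < m) <<mxvec (relel p i j)>>)%MS.

(* Aut_gr(S_p(U)) viewed inside GL(U): the invertible g whose degree-one
   action extends to a (graded) algebra automorphism, i.e. with
   (g (x) g)(R_p) contained in R_p. *)
Definition Autgr (m : nat) (p : 'M[k]_m) (g : 'M[k]_m) : Prop :=
  g \in unitmx /\
  forall i j, (mxvec (g^T *m relel p i j *m g) <= relspace p)%MS.

(* prod_{B in B_q, B' in B_q'} GL(V_B (x) V'_B') as a subgroup of GL(V (x) V'):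
   the invertible matrices that are block diagonal w.r.t. the blocks B x B'. *)
Definition prodGL (n n' : nat) (q : 'M[k]_n) (q' : 'M[k]_n')
    (g : 'M[k]_(n * n')) : Prop :=
  g \in unitmx /\
  forall a b : 'I_(n * n'), g a b != 0 ->
    (row (kidx a).1 q == row (kidx b).1 q) &&
    (row (kidx a).2 q' == row (kidx b).2 q').

End QPM.

(* Main.v *)
Require Import Defs.
From HB Require Import structures.
From mathcomp Require Import all_boot all_order all_fingroup all_algebra ring.
Import GRing.Theory.
Local Open Scope ring_scope.
Set Implicit Arguments. Unset Strict Implicit. Unset Printing Implicit Defensive.

(* An invertible matrix g is a graded automorphism of S_p exactly when
   p_cd = p_ij for all nonzero entries g_ic, g_jd.  Hence g permutes the blocks
   of p by some t in Stab(p), and the supports of the matrices inducing t = 1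
   are block diagonal.  For p = q (x) q', multiplicative independence lets one
   split an equality of entries of p into equalities of entries of q and of q';
   so the blocks of p are the products B x B', and t is a pair of permutations,
   one in Stab(q) and one in Stab(q').  The complement is realized by the
   permutation matrices that preserve the rank of an index in its block. *)

(** * Supports and minors of invertible matrices *)

Section Support.
Context {k : fieldType} {m : nat}.
Implicit Types g h : 'M[k]_m.

(** With matrices acting on row vectors, [g] carries the span of the basis vectors labelled [t] by
    [u] into the span of those labelled [t] by [v]. Taking for [u] the map [v] followed by a
    permutation of the labels expresses that [g] permutes blocks. *)
Definition supported {T : eqType} (u v : 'I_m -> T) g :=
  forall a b, g a b != 0 -> u a = v b.

Lemma supported_mul {T : eqType} (u v w : 'I_m -> T) g h :
  supported u v g -> supported v w h -> supported u w (g *m h).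
Proof.
move=> ug vh a b; apply: contraNeq => uw; rewrite mxE big1 // => c _.
apply/eqP; rewrite mulf_eq0; case: eqVneq => //= /ug uv.
by apply: contraNT uw => /vh <-; rewrite uv.
Qed.

(* Support on [u a = v b] means that g intertwines the diagonal matrices of
   indicator functions composed with u and v, a condition stable under
   inversion. *)
Lemma supported_inv {T : eqType} (u v : 'I_m -> T) g :
  g \in unitmx -> supported u v g -> supported v u (invmx g).
Proof.
move=> gU ug a b nz.
pose D (f : 'I_m -> T) : 'M[k]_m := diag_mx (\row_c (f c == v a)%:R).
have gD : D u *m g = g *m D v.
  apply/matrixP=> c d; rewrite mul_diag_mx mul_mx_diag !mxE.
  by case: (eqVneq (g c d) 0) => [->|/ug ->]; rewrite ?mulr0 ?mul0r // mulrC.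
have /matrixP/(_ a b) : invmx g *m D u = D v *m invmx g.
  by rewrite -[LHS](mulmxK gU) -(mulmxA (invmx g)) gD mulKmx.
rewrite mul_diag_mx mul_mx_diag !mxE eqxx mul1r.
by case: eqVneq => // _ /eqP; rewrite mulr0 eq_sym (negPf nz).
Qed.

Lemma unitmx_row_neq0 g a : g \in unitmx -> exists b, g a b != 0.
Proof.
move=> gU; apply/existsP; apply: contraT; rewrite negb_exists => /forallP g0.
have /matrixP/(_ a a) := mulmxV gU.
rewrite !mxE eqxx big1 => [/eqP|b _]; first by rewrite eq_sym oner_eq0.
by move: (g0 b); rewrite negbK => /eqP ->; rewrite mul0r.
Qed.

Lemma unitmx_col_neq0 g b : g \in unitmx -> exists a, g a b != 0.
Proof.
by rewrite -unitmx_tr => /(unitmx_row_neq0 b)[a]; rewrite mxE; exists a.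
Qed.

(** Some term of the Leibniz expansion of the nonzero determinant is nonzero. *)
Lemma unitmx_transversal g :
  g \in unitmx -> exists s : 'S_m, forall i, g i (s i) != 0.
Proof.
move=> gU.
suff /existsP[s /forallP gs] : [exists s : 'S_m, [forall i, g i (s i) != 0]].
  by exists s.
apply: contraTT gU; rewrite negb_exists unitmxE unitfE negbK => /forallP g0; apply/eqP.
rewrite /determinant big1 // => s _; apply/eqP; rewrite mulf_eq0; apply/orP; right.
have /forallPn[i] := g0 s.
by rewrite negbK => /eqP gi; rewrite (bigD1 i) //= gi mul0r.
Qed.

(** If all these minors vanished, the columns would be proportional; pairing them with row [c] of
    the inverse, which gives 1 on column [c] and 0 on column [d], would make column [d] zero. *)
Lemma unitmx_minor_neq0 g c d : g \in unitmx -> c != d ->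
  exists i j, g i c * g j d != g j c * g i d.
Proof.
move=> gU cd.
suff /existsP[i /existsP[j ij]] :
    [exists i, exists j, g i c * g j d != g j c * g i d].
  by exists i, j.
apply: contraT; rewrite negb_exists => /forallP gm.
have {}gm i j : g i c * g j d = g j c * g i d.
  by move: (gm i); rewrite negb_exists => /forallP/(_ j); rewrite negbK => /eqP.
have [j] := unitmx_col_neq0 d gU; apply: contraNT => _.
have /matrixP gV := mulVmx gU.
have -> : g j d = (invmx g *m g) c c * g j d by rewrite gV mxE eqxx mul1r.
have -> : (invmx g *m g) c c * g j d = (invmx g *m g) c d * g j c.
  rewrite !mxE !mulr_suml; apply: eq_bigr => i _.
  by rewrite -!mulrA gm [g j c * _]mulrC.
by rewrite gV mxE (negPf cd) mul0r.
Qed.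

End Support.

(** * Quadratic relations and graded automorphisms *)

Section QuantumParameters.
Context {k : fieldType} {m : nat}.
Variable p : 'M[k]_m.
Hypothesis pP : qpm p.

Lemma qpm_diag i : p i i = 1. Proof. by case: pP. Qed.

Lemma qpm_inv i j : p i j * p j i = 1. Proof. by case: pP. Qed.

Lemma qpm_neq0 i j : p i j != 0.
Proof. by apply: contra_eq_neq (qpm_inv i j) => ->; rewrite mul0r eq_sym oner_neq0. Qed.

Lemma qpm_sym i j : p j i = (p i j)^-1.
Proof. by apply: (mulfI (qpm_neq0 i j)); rewrite qpm_inv divff ?qpm_neq0. Qed.

(** The equations are linear functionals that vanish on every generator; conversely, they allow an
    explicit expansion of [X] in the generators. *)
Lemma relspaceP (X : 'M[k]_m) :
  reflect ((forall i, X i i = 0) /\ forall i j, X i j + p i j * X j i = 0)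
    (mxvec X <= relspace p)%MS.
Proof.
have pick (Y : 'M[k]_m) i j :
    mxvec Y *m (mxvec (delta_mx i j))^T = (Y i j)%:M :> 'M_1.
  rewrite mxvec_delta trmx_delta -colE; apply/matrixP=> a b.
  by rewrite !ord1 !mxE mulr1n mxvecE.
have zero (w : 'M[k]_m) : (forall i j, mxvec (relel p i j) *m (mxvec w)^T = 0) ->
    (mxvec X <= relspace p)%MS -> mxvec X *m (mxvec w)^T = 0.
  move=> w0 Xp; apply/sub_kermxP/(submx_trans Xp).
  apply/sumsmx_subP => i _; apply/sumsmx_subP => j _; rewrite genmxE.
  exact/sub_kermxP.
apply: (iffP idP) => [Xp|[X0 Xp]].
  split=> [i|i j].
    have := zero (delta_mx i i) _ Xp; rewrite pick => /(_ _)/matrixP/(_ 0 0).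
    rewrite !mxE mulr1n; apply => a b; rewrite pick !mxE.
    case: (eqVneq i a) => [<-|]; case: (eqVneq i b) => [<-|];
      by rewrite ?qpm_diag ?mulr0 ?mulr1 ?subrr ?subr0 ?raddf0.
  have wE (Y : 'M[k]_m) : mxvec Y *m (mxvec (delta_mx i j + p i j *: delta_mx j i))^T
      = (Y i j + p i j * Y j i)%:M :> 'M_1.
    rewrite linearD linearZ /= linearD linearZ /= mulmxDr -scalemxAr !pick.
    by rewrite scale_scalar_mx raddfD.
  have := zero (delta_mx i j + p i j *: delta_mx j i) _ Xp; rewrite wE.
  move=> /(_ _)/matrixP/(_ 0 0).
  rewrite !mxE mulr1n; apply => a b; rewrite wE !mxE.
  (* The functional takes on [relel p a b] the value [u * (p i j - p a b) + v * (1 - p i j * p a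
     b)], and both terms vanish. *)
  set u := (i == a) && (j == b); set v := (i == b) && (j == a).
  have -> : (j == b) && (i == a) = u by rewrite andbC.
  have -> : (j == a) && (i == b) = v by rewrite andbC.
  have u0 : u%:R * (p i j - p a b) = 0.
    by rewrite /u; case: eqP => [->|]; case: eqP => [->|]; rewrite ?mul0r ?subrr ?mulr0.
  have v0 : v%:R * (1 - p i j * p a b) = 0.
    by rewrite /v; case: eqP => [->|]; case: eqP => [->|]; rewrite ?mul0r // qpm_inv subrr mulr0.
  apply/matrixP=> x y; rewrite !ord1 [LHS]mxE [RHS]mxE mulr1n.
  by rewrite -[RHS](addr0 0) -{1}u0 -v0; ring.
(* For [i < j] the summand contributes [X j i] at entry [(j, i)] and [- p i j * X j i], which is
   [X i j], at entry [(i, j)]. *)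
have -> : X = \sum_(i < m) \sum_(j < m) (if (i < j)%N then X j i else 0) *: relel p i j.
  have pick_entry (F : 'I_m -> 'I_m -> k) c d :
      \sum_i \sum_j F i j * ((c == i) && (d == j))%:R = F c d.
    rewrite (bigD1 c) //= (bigD1 d) //= !eqxx mulr1 !big1 ?addr0 // => [i|j jd]; last first.
      by rewrite eq_sym (negPf jd) mulr0.
    by move=> ic; rewrite big1 // => j _; rewrite eq_sym (negPf ic) mulr0.
  apply/matrixP=> c d; rewrite summxE.
  pose A (i j : 'I_m) := if (i < j)%N then X j i else 0.
  transitivity (A d c - p c d * A c d).
    rewrite /A; case: (ltngtP c d) => [cd|cd|/val_inj->]; last by rewrite mulr0 subrr X0.
      by rewrite sub0r; apply/eqP; rewrite -subr_eq0 opprK Xp.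
    by rewrite mulr0 subr0.
  rewrite -(pick_entry (fun i j => p i j * A i j)) -(pick_entry A) exchange_big /=.
  rewrite [X in X - _]exchange_big /= -sumrB; apply: eq_bigr => i _; rewrite summxE -sumrB.
  apply: eq_bigr => j _; rewrite !mxE mulrBr -/(A i j) andbC mulrCA mulrA.
  by [].
rewrite linear_sum summx_sub // => i _; rewrite linear_sum summx_sub // => j _.
by rewrite linearZ scalemx_sub // (sumsmx_sup i) // (sumsmx_sup j) // genmxE.
Qed.

Lemma relel_actE (g : 'M[k]_m) i j c d :
  (g^T *m relel p i j *m g) c d = g j c * g i d - p i j * (g i c * g j d).
Proof.
have act_delta a b : (g^T *m delta_mx a b *m g) c d = g a c * g b d.
  rewrite -[delta_mx a b](mul_delta_mx (0 : 'I_1)) !mulmxA -colE -mulmxA -rowE.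
  by rewrite !mxE big_ord1 !mxE.
by rewrite mulmxBr mulmxBl -scalemxAr -scalemxAl !mxE -!act_delta !mxE.
Qed.

Lemma AutgrP (g : 'M[k]_m) :
  Autgr p g <-> g \in unitmx /\
    forall i j c d, g i c != 0 -> g j d != 0 -> p c d = p i j.
Proof.
split=> [[gU gR]|[gU gp]].
  split=> // i j c d gic gjd.
  have gdiag a b e : p a b != 1 -> g a e * g b e = 0.
    have [/(_ e) + _] := relspaceP _ (gR a b).
    rewrite relel_actE => E ab; apply/eqP; move/eqP: E.
    rewrite [g b e * _]mulrC -{1}[_ * g b e]mul1r -mulrBl mulf_eq0 subr_eq0.
    by rewrite eq_sym (negPf ab).
  have gE a b e f : (p e f - p a b) * (g a e * g b f)
      = (p e f * p a b - 1) * (g b e * g a f).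
    have [_ /(_ e f)] := relspaceP _ (gR a b).
    rewrite !relel_actE => E; apply/eqP; rewrite -subr_eq0 -E; apply/eqP; ring.
  (* Two columns whose parameter is not 1 have disjoint supports: by [gdiag]
     and [gE], every row meeting both of them would be incompatible with the
     rows of a nonzero minor in these columns. *)
  have gcol a e f : p e f != 1 -> g a e * g a f = 0.
    move=> ef; apply/eqP; rewrite mulf_eq0; apply: contraT.
    rewrite negb_or => /andP[ae af].
    have ef' : e != f by apply: contra_neq ef => ->; exact: qpm_diag.
    have minor b b' : p b b' = 1 -> g b e * g b' f = g b' e * g b f.
      move=> bb'; have := gE b b' e f; rewrite bb' mulr1 => /mulfI; apply.
      by rewrite subr_eq0.
    have same b : g b e != 0 \/ g b f != 0 -> p a b = 1.
      move=> gb; apply/eqP/contraT => /gdiag ab; case: gb => /negP[].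
        by move/eqP: (ab e); rewrite mulf_eq0 (negPf ae).
      by move/eqP: (ab f); rewrite mulf_eq0 (negPf af).
    have [b [b' /eqP[]]] := unitmx_minor_neq0 gU ef'.
    (* Every row is proportional to row [a] in columns [e] and [f], so all minors in these columns
       vanish. *)
    have eq_a x : g a e * g x f = g x e * g a f.
      have [/orP/same/minor//|] := boolP ((g x e != 0) || (g x f != 0)).
      by rewrite negb_or !negbK => /andP[/eqP-> /eqP->]; rewrite mulr0 mul0r.
    by apply: (mulfI ae); rewrite mulrCA eq_a [RHS]mulrCA eq_a; ring.
  (* If [p i j] or [p c d] differs from 1, then [g j c = 0] by [gdiag] or by [gcol]. This kills the
     right side of [gE], leaving a nonzero product times [p c d - p i j]. *)
  case: (eqVneq (p i j) 1) => [ij|ij]; last first.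
    have gjc : g j c = 0.
      by move/eqP: (gdiag _ _ c ij); rewrite mulf_eq0 (negPf gic) => /eqP.
    move/eqP: (gE i j c d); rewrite gjc mul0r mulr0 mulf_eq0 subr_eq0.
    by rewrite mulf_eq0 (negPf gic) (negPf gjd) => /orP[/eqP|].
  rewrite ij; apply/eqP; apply: contraT => cd.
  have gjc : g j c = 0.
    by move/eqP: (gcol j _ _ cd); rewrite mulf_eq0 (negPf gjd) orbF => /eqP.
  have := gE i j c d; rewrite ij gjc mul0r mulr0 => /eqP.
  by rewrite !mulf_eq0 (negPf gic) (negPf gjd) subr_eq0 (negPf cd).
split=> // i j; apply/relspaceP; split=> [c|c d]; rewrite !relel_actE.
  have [->|gic] := eqVneq (g i c) 0; first by rewrite !(mul0r, mulr0) subrr.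
  have [->|gjc] := eqVneq (g j c) 0; first by rewrite !(mul0r, mulr0) subrr.
  by rewrite -(gp i j c c) // qpm_diag mul1r mulrC subrr.
have u0 : (p c d - p i j) * (g i c * g j d) = 0.
  have [->|gic] := eqVneq (g i c) 0; first by rewrite !(mul0r, mulr0).
  have [->|gjd] := eqVneq (g j d) 0; first by rewrite !(mul0r, mulr0).
  by rewrite (gp i j c d) // subrr mul0r.
have v0 : (1 - p i j * p c d) * (g j c * g i d) = 0.
  have [->|gjc] := eqVneq (g j c) 0; first by rewrite !(mul0r, mulr0).
  have [->|gid] := eqVneq (g i d) 0; first by rewrite !(mul0r, mulr0).
  by rewrite (gp j i c d) // qpm_inv subrr mul0r.
by rewrite -[RHS](addr0 0) -{1}u0 -v0; ring.
Qed.

(** * Blocks, [Stab] and induced block permutations *)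

Fact block_of_subproof i : [set j | row j p == row i p] \in blocks p.
Proof. exact: imset_f. Qed.

Definition block_of i : blk p := exist (fun B => B \in blocks p) _ (block_of_subproof i).

Lemma mem_block (B : blk p) i : (i \in val B) = (block_of i == B).
Proof.
case: B => B pB; have /imsetP[j _ BE] := pB; rewrite -val_eqE /= BE inE.
apply/eqP/eqP => [->//|/setP/(_ i)]; rewrite !inE eqxx => /esym/eqP //.
Qed.

Lemma block_of_eq i j : (block_of i == block_of j) = (row i p == row j p).
Proof. by rewrite -mem_block inE. Qed.

Lemma block_of_surj B : exists i, block_of i = B.
Proof.
case: B => B pB; have /imsetP[j _ BE] := pB.
by exists j; apply/val_inj; rewrite /= BE.
Qed.

(** Rows may be exchanged within a block by definition; columns follow because transposed entries
    are inverse to each other. *)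
Lemma qpm_block i j i' j' :
  block_of i = block_of i' -> block_of j = block_of j' -> p i j = p i' j'.
Proof.
move=> /eqP; rewrite block_of_eq => /eqP/rowP ii' /eqP.
rewrite block_of_eq => /eqP/rowP jj'.
have -> : p i j = p i' j by move: (ii' j); rewrite !mxE.
by rewrite qpm_sym [RHS]qpm_sym; move: (jj' i'); rewrite !mxE => ->.
Qed.

Lemma card_block_gt0 (B : blk p) : (0 < #|val B|)%N.
Proof.
by have [i iB] := block_of_surj B; apply/card_gt0P; exists i; rewrite mem_block iB.
Qed.

Lemma StabP (s : {perm blk p}) :
  reflect ((forall B, #|val (s B)| = #|val B|) /\
    forall i j i' j', block_of i' = s (block_of i) ->
      block_of j' = s (block_of j) -> p i j = p i' j')
    (s \in Stab p).
Proof.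
rewrite inE; apply: (iffP andP) => -[s1 s2]; split.
- by move=> B; exact/eqP/(forallP s1).
- move=> i j i' j' ii' jj'; apply/eqP.
  move: s2 => /forallP/(_ (block_of i))/forallP/(_ (block_of j))/forallP/(_ i).
  move=> /forallP/(_ j)/forallP/(_ i')/forallP/(_ j')/implyP; apply.
  by rewrite !mem_block ii' jj' !eqxx.
- by apply/forallP=> B; rewrite s1.
- do 6 apply/forallP => ?; rewrite !mem_block.
  by apply/implyP => /and4P[/eqP<- /eqP<- /eqP ? /eqP ?]; apply/eqP/s2.
Qed.

Lemma group_set_Stab : group_set (Stab p).
Proof.
apply/group_setP; split.
  apply/StabP; split=> [B|i j i' j']; first by rewrite perm1.
  by rewrite !perm1 => ii' jj'; apply: qpm_block.
move=> s t /StabP[s1 s2] /StabP[t1 t2]; apply/StabP; split=> [B|i j i' j'].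
  by rewrite permM t1 s1.
rewrite !permM => ii' jj'.
have [[a aE] [b bE]] := (block_of_surj (s (block_of i)), block_of_surj (s (block_of j))).
by rewrite (s2 i j a b) // (t2 a b i' j') // ?aE ?bE.
Qed.

Definition Stab_group := Group group_set_Stab.

Lemma Stab_Autgr (g : 'M[k]_m) t : t \in Stab p -> g \in unitmx ->
  supported (t \o block_of) block_of g -> Autgr p g.
Proof.
move=> /StabP[_ tp] gU gt; apply/AutgrP; split=> // i j c d /gt ic /gt jd.
by rewrite (tp i j c d).
Qed.

(** A correspondence [T], total on both sides and compatible with the entries, transports equality
    of rows: each column on one side is compared with a [T]-related column on the other. It thus
    descends to a bijection of blocks. The map [h] lets [T] live on pairs of indices, of which [h]
    is a coordinate. *)
Lemma block_perm (I : finType) (h : I -> 'I_m) (T : rel I) :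
    (forall i, exists a, h a = i) ->
    (forall a, exists a', T a a') -> (forall a', exists a, T a a') ->
    (forall a b a' b', T a a' -> T b b' -> p (h a) (h b) = p (h a') (h b')) ->
  exists s : {perm blk p},
    (forall a a', T a a' -> s (block_of (h a)) = block_of (h a')) /\
    (forall i j i' j', block_of i' = s (block_of i) ->
      block_of j' = s (block_of j) -> p i j = p i' j').
Proof.
move=> h_surj T_r T_l Tp.
have Tblock a b a' b' : T a a' -> T b b' ->
    (block_of (h a) == block_of (h b)) = (block_of (h a') == block_of (h b')).
  move=> aa' bb'; rewrite !block_of_eq.
  apply/eqP/eqP => /rowP E; apply/rowP => l; have [c hc] := h_surj l.
    have [e ec] := T_l c; rewrite !mxE -hc -(Tp _ _ _ _ aa' ec) -(Tp _ _ _ _ bb' ec).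
    by move: (E (h e)); rewrite !mxE.
  have [e ce] := T_r c; rewrite !mxE -hc (Tp _ _ _ _ aa' ce) (Tp _ _ _ _ bb' ce).
  by move: (E (h e)); rewrite !mxE.
have repP B : exists aa' : I * I, T aa'.1 aa'.2 && (block_of (h aa'.1) == B).
  have [i <-] := block_of_surj B; have [a <-] := h_surj i; have [a' aa'] := T_r a.
  by exists (a, a'); rewrite /= aa' eqxx.
pose s0 B := block_of (h (xchoose (repP B)).2).
have s0E a a' : T a a' -> s0 (block_of (h a)) = block_of (h a').
  move=> aa'; have /andP[bb' ab] := xchooseP (repP (block_of (h a))).
  by apply/eqP; rewrite -(Tblock _ _ _ _ bb' aa').
have blockP B : exists aa' : I * I, T aa'.1 aa'.2 /\ B = block_of (h aa'.1).
  by have [[a a'] /andP[aa' /eqP <-]] := repP B; exists (a, a').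
have s0I : injective s0.
  move=> B C; have [[[a a'] [/= aa' ->]] [[b b'] [/= bb' ->]]] := (blockP B, blockP C).
  by rewrite (s0E _ _ aa') (s0E _ _ bb') => /eqP; rewrite -(Tblock _ _ _ _ aa' bb') => /eqP.
exists (perm s0I); split=> [a a' /s0E|i j i' j']; rewrite !permE //.
have [[a <-] [b <-]] := (h_surj i, h_surj j).
have [[a' aa'] [b' bb']] := (T_r a, T_r b).
rewrite (s0E _ _ aa') (s0E _ _ bb') (Tp _ _ _ _ aa' bb') => /esym ii' /esym jj'.
exact: qpm_block.
Qed.

Lemma Autgr_Stab (g : 'M[k]_m) : Autgr p g ->
  exists2 t, t \in Stab p & supported (t \o block_of) block_of g.
Proof.
move=> /AutgrP[gU gp].
have [||||t [tE tp]] := @block_perm _ id (fun i c => g i c != 0).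
- by move=> i; exists i.
- by move=> i; apply: unitmx_row_neq0.
- by move=> c; apply: unitmx_col_neq0.
- by move=> i j c d gic gjd; rewrite (gp i j c d).
exists t => [|i c /tE //]; apply/StabP; split=> // B.
(* The permutation [s] inside the support of [g] maps [B] bijectively onto its image block, so the
   sizes agree. *)
have [s gs] := unitmx_transversal gU.
rewrite -(card_imset (val B) (@perm_inj _ s)); apply/eq_card => c.
have [i <-] := block_of_surj B; rewrite -(permKV s c) mem_block (tE _ _ (gs i)).
rewrite -(tE _ _ (gs i)) -(tE _ _ (gs (s^-1 c)%g)) (inj_eq perm_inj).
by rewrite mem_imset ?mem_block //; apply: perm_inj.
Qed.

(* [block_lift s] preserves the rank of an index inside its block so as to be
   multiplicative in [s]. *)
Definition block_lift (s : {perm blk p}) (i : 'I_m) : 'I_m :=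
  nth i (enum (val (s (block_of i)))) (index i (enum (val (block_of i)))).

Lemma block_lift_rank s i : s \in Stab p ->
  (index i (enum (val (block_of i))) < size (enum (val (s (block_of i)))))%N.
Proof. by move=> /StabP[s1 _]; rewrite -cardE s1 cardE index_mem mem_enum mem_block. Qed.

Lemma block_of_lift s i : s \in Stab p -> block_of (block_lift s i) = s (block_of i).
Proof. by move=> sP; apply/eqP; rewrite -mem_block -mem_enum mem_nth ?block_lift_rank. Qed.

Lemma block_liftM s t i : s \in Stab p -> t \in Stab p ->
  block_lift (s * t)%g i = block_lift t (block_lift s i).
Proof.
move=> sP tP; have stP : (s * t)%g \in Stab_group by rewrite groupM.
rewrite [RHS]/block_lift block_of_lift // {3}/block_lift.
rewrite index_uniq ?block_lift_rank ?enum_uniq //.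
(* The two sides differ only in the default of [nth], which is never reached since the rank is in
   range. *)
by rewrite /block_lift permM; apply: set_nth_default; rewrite -permM block_lift_rank.
Qed.

Lemma block_lift1 i : block_lift 1%g i = i.
Proof. by rewrite /block_lift perm1 nth_index // mem_enum mem_block. Qed.

End QuantumParameters.

(** * Blocks and stabilizer of a Kronecker product *)

Section Kronecker.
Context {k : fieldType} {n n' : nat}.
Variables (q : 'M[k]_n) (q' : 'M[k]_n').
Hypotheses (qP : qpm q) (q'P : qpm q') (qq' : mult_indep q q').
Let p := qkron q q'.

Lemma mxvec_indexK (i : 'I_n) (i' : 'I_n') : kidx (mxvec_index i i') = (i, i').
Proof. by rewrite /kidx /mxvec_index cast_ordK enum_rankK. Qed.

Lemma kidxK (a : 'I_(n * n')) : mxvec_index (kidx a).1 (kidx a).2 = a.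
Proof. by case/mxvec_indexP: a => i i'; rewrite mxvec_indexK. Qed.

Lemma qkron_qpm : qpm p.
Proof.
split=> [a|a b]; rewrite !mxE; first by rewrite !qpm_diag // mulr1.
by rewrite mulrACA !qpm_inv // mulr1.
Qed.
Let pP := qkron_qpm.

(** Independence requires 1 to be a product of entries of each matrix, so both matrices have
    entries. *)
Lemma mult_indep_gt0 : (0 < n)%N /\ (0 < n')%N.
Proof.
have [_ /(_ erefl)[[i _] [i' _]]] := qq' 1.
by split; [apply: leq_trans (ltn_ord i) | apply: leq_trans (ltn_ord i')].
Qed.

(** From [x * x' = y * y'] one gets [x / y = y' / x']. Since the inverse of an entry is again an
    entry, this common value is a product of two entries of [q] and also of two entries of [q'],
    hence 1. *)
Lemma qkron_eq (a b c d : 'I_(n * n')) : p a b = p c d ->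
  q (kidx a).1 (kidx b).1 = q (kidx c).1 (kidx d).1 /\
  q' (kidx a).2 (kidx b).2 = q' (kidx c).2 (kidx d).2.
Proof.
rewrite !mxE; set x := q _ _; set x' := q' _ _; set y := q _ _; set y' := q' _ _ => E.
have [x'0 y0] : x' != 0 /\ y != 0 by rewrite !qpm_neq0.
have xy : x / y = y' / x' by apply/eqP; rewrite eqr_div // [y' * y]mulrC E.
have xy1 : x / y = 1.
  apply/qq'; split; last rewrite xy.
    by exists (kidx a).1, (kidx b).1, (kidx d).1, (kidx c).1; rewrite [q (kidx d).1 _]qpm_sym.
  by exists (kidx c).2, (kidx d).2, (kidx b).2, (kidx a).2; rewrite [q' (kidx b).2 _]qpm_sym.
split; first by rewrite -[x](divfK y0) xy1 mul1r.
by rewrite -[y'](divfK x'0) -xy xy1 mul1r.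
Qed.

Definition pblock (a : 'I_(n * n')) : blk q * blk q' :=
  (block_of q (kidx a).1, block_of q' (kidx a).2).

Lemma pblock_surj X : exists a, pblock a = X.
Proof.
case: X => B B'; have [i <-] := block_of_surj B; have [i' <-] := block_of_surj B'.
by exists (mxvec_index i i'); rewrite /pblock mxvec_indexK.
Qed.

Lemma block_of_kron a b : (block_of p a == block_of p b) = (pblock a == pblock b).
Proof.
rewrite block_of_eq xpair_eqE !block_of_eq.
apply/eqP/andP => [/rowP E|[/eqP/rowP E /eqP/rowP E']]; last first.
  by apply/rowP => c; move: (E (kidx c).1) (E' (kidx c).2); rewrite !mxE => -> ->.
have {}E c : p a c = p b c by move: (E c); rewrite [LHS]mxE [RHS]mxE.
split; apply/eqP/rowP => l; rewrite !mxE.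
  by have [+ _] := qkron_eq (E (mxvec_index l (kidx a).2)); rewrite mxvec_indexK.
by have [_ +] := qkron_eq (E (mxvec_index (kidx a).1 l)); rewrite mxvec_indexK.
Qed.

Lemma pblock_surjP X : exists a, pblock a == X.
Proof. by have [a <-] := pblock_surj X; exists a. Qed.

Lemma block_surjP (B : blk p) : exists a, block_of p a == B.
Proof. by have [a <-] := block_of_surj B; exists a. Qed.

(** An index of [B] x [B'] is chosen; by [block_of_kron] the resulting block does not depend on the
    choice. *)
Definition kblock (X : blk q * blk q') : blk p := block_of p (xchoose (pblock_surjP X)).

Definition kunblock (B : blk p) : blk q * blk q' := pblock (xchoose (block_surjP B)).

Lemma kblockE a : kblock (pblock a) = block_of p a.
Proof. by apply/eqP; rewrite block_of_kron; apply: (xchooseP (pblock_surjP _)). Qed.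

Lemma kunblockE a : kunblock (block_of p a) = pblock a.
Proof. by apply/eqP; rewrite -block_of_kron; apply: (xchooseP (block_surjP _)). Qed.

Lemma kblockK : cancel kblock kunblock.
Proof. by move=> X; have [a <-] := pblock_surj X; rewrite kblockE kunblockE. Qed.

Lemma kunblockK : cancel kunblock kblock.
Proof. by move=> B; have [a <-] := block_of_surj B; rewrite kunblockE kblockE. Qed.

Lemma card_kblock X : #|val (kblock X)| = (#|val X.1| * #|val X.2|)%N.
Proof.
pose f (ii : 'I_n * 'I_n') := mxvec_index ii.1 ii.2.
have fI : injective f.
  by move=> [i i'] [j j'] /(congr1 (@kidx n n')); rewrite !mxvec_indexK.
rewrite -cardsX -(card_imset _ fI); apply/eq_card => a.
rewrite mem_block -[in RHS](kidxK a : f (kidx a) = a) mem_imset // inE !mem_block.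
by rewrite -(inj_eq (can_inj kunblockK)) kunblockE kblockK -xpair_eqE; case: X.
Qed.

Definition kact (x : {perm blk q} * {perm blk q'}) (X : blk q * blk q') :=
  (x.1 X.1, x.2 X.2).

Lemma kactM x y X : kact (x * y)%g X = kact y (kact x X).
Proof. by rewrite /kact !permM. Qed.

Lemma kact1 X : kact 1%g X = X.
Proof. by case: X => B B'; rewrite /kact !perm1. Qed.

Lemma kact_faithful x y : (forall a, kact x (pblock a) = kact y (pblock a)) -> x = y.
Proof.
have [/Ordinal i /Ordinal i'] := mult_indep_gt0.
case: x y => [s s'] [t t'] E; congr pair; apply/permP => B.
  by have [a aE] := pblock_surj (B, block_of q' i'); have := E a; rewrite aE => -[].
by have [a aE] := pblock_surj (block_of q i, B); have := E a; rewrite aE => -[].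
Qed.

Lemma kperm_subproof x : injective (kblock \o kact x \o kunblock).
Proof.
apply: inj_comp (can_inj kunblockK); apply: inj_comp (can_inj kblockK) _.
by apply: (can_inj (g := kact x^-1%g)) => X; rewrite -kactM mulgV kact1.
Qed.

Definition kperm x : {perm blk p} := perm (@kperm_subproof x).

Lemma kpermM x y : kperm (x * y)%g = (kperm x * kperm y)%g.
Proof. by apply/permP => B; rewrite permM !permE /= kblockK kactM. Qed.

Lemma kpermE x a b :
  (kperm x (block_of p a) == block_of p b) = (kact x (pblock a) == pblock b).
Proof. by rewrite permE /= kunblockE -kblockE (inj_eq (can_inj kblockK)). Qed.

Lemma kperm_kblock x X : kperm x (kblock X) = kblock (kact x X).
Proof. by rewrite permE; congr (kblock (kact x _)); apply: kblockK. Qed.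

Lemma kperm_inj : injective kperm.
Proof.
move=> x y xy; apply: kact_faithful => a; have [b bE] := pblock_surj (kact x (pblock a)).
by rewrite -bE; apply/esym/eqP; rewrite -kpermE -xy kpermE bE.
Qed.

Lemma kperm_Stab x : x \in setX (Stab q) (Stab q') -> kperm x \in Stab p.
Proof.
case: x => s s'; rewrite in_setX => /andP[/StabP[s1 s2] /StabP[s1' s2']].
apply/StabP; split=> [B|a b a' b' /esym/eqP + /esym/eqP].
  by rewrite -(kunblockK B) kperm_kblock [LHS]card_kblock [RHS]card_kblock s1 s1'.
rewrite !kpermE => /eqP[/esym aa1 /esym aa2] /eqP[/esym bb1 /esym bb2].
by rewrite !mxE (s2 _ _ _ _ aa1 bb1) (s2' _ _ _ _ aa2 bb2).
Qed.

(* By multiplicative independence an automorphism of the entries of [p]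
   preserves both Kronecker factors separately.  It only preserves the products
   of the block sizes; summing over the blocks of [q'] (or [q]) recovers
   the individual sizes. *)
Lemma kperm_surj t : t \in Stab p ->
  exists2 x, x \in setX (Stab q) (Stab q') & t = kperm x.
Proof.
move=> /StabP[t1 t2].
pose T a a' := block_of p a' == t (block_of p a).
have T_r a : exists a', T a a'.
  by have [a' aE] := block_of_surj (t (block_of p a)); exists a'; apply/eqP.
have T_l a' : exists a, T a a'.
  have [a aE] := block_of_surj ((t^-1)%g (block_of p a')); exists a.
  by rewrite /T aE permKV.
have T_q a b a' b' : T a a' -> T b b' -> p a b = p a' b'.
  by move=> /eqP aa' /eqP bb'; apply: t2.
have [/Ordinal i0 /Ordinal i0'] := mult_indep_gt0.
(* [T] relates pairs of indices; read through its first coordinate it preserves the entries of [q]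
   by [qkron_eq], and below, through the second, those of [q']. *)
have [|a b a' b' /T_q ab /ab /qkron_eq[]//|s [sT sq]] :=
    @block_perm _ _ _ qP _ (fun a => (kidx a).1) T _ T_r T_l.
  by move=> i; exists (mxvec_index i i0'); rewrite mxvec_indexK.
have [|a b a' b' /T_q ab /ab /qkron_eq[]//|s' [sT' sq']] :=
    @block_perm _ _ _ q'P _ (fun a => (kidx a).2) T _ T_r T_l.
  by move=> i; exists (mxvec_index i0 i); rewrite mxvec_indexK.
have tE : t = kperm (s, s').
  apply/permP => B; have [a <-] := block_of_surj B; have [a' aa'] := T_r a.
  rewrite -(eqP aa'); apply/esym/eqP; rewrite kpermE.
  by rewrite /kact /= (sT _ _ aa') (sT' _ _ aa').
have cards X : (#|val (s X.1)| * #|val (s' X.2)| = #|val X.1| * #|val X.2|)%N.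
  rewrite -[RHS]card_kblock -(t1 (kblock X)) tE kperm_kblock.
  by rewrite [RHS]card_kblock.
have sum_gt0 r (u : 'M[k]_r) (i : 'I_r) :
    (0 < \sum_(B : blk u) #|val B|)%N.
  by rewrite (bigD1 (block_of u i)) // addn_gt0 card_block_gt0.
have sum_perm r (u : 'M[k]_r) (v : {perm blk u}) :
    (\sum_(B : blk u) #|val B| = \sum_(B : blk u) #|val (v B)|)%N.
  exact: reindex_inj perm_inj.
exists (s, s') => //; rewrite in_setX; apply/andP; split; apply/StabP => //; split=> // B.
  apply/eqP; rewrite -(eqn_pmul2r (sum_gt0 _ q' i0')).
  rewrite {1}(sum_perm _ q' s') !big_distrr.
  by apply/eqP/eq_bigr => B' _; apply: (cards (B, B')).
apply/eqP; rewrite -(eqn_pmul2l (sum_gt0 _ q i0)).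
rewrite {1}(sum_perm _ q s) !big_distrl.
by apply/eqP/eq_bigr => B' _; apply: (cards (B', B)).
Qed.

Lemma Stab_qkron_isog : (Stab p \isog setX (Stab q) (Stab q'))%g.
Proof.
have := isog_sym (setX_group (Stab_group qP) (Stab_group q'P)) (Stab_group pP).
rewrite /= => <-; apply: (@misom_isog _ _ _ _ kperm); rewrite /misom.
apply/andP; split; first by apply/morphicP => x y _ _; apply: kpermM.
(* Mapping the non-identity elements onto the non-identity elements encodes both the trivial kernel
   and surjectivity. *)
apply/eqP/setP => t; apply/imsetP/idP => [[x]|].
  rewrite in_setD1 => /andP[x1 xK] ->; rewrite in_setD1 kperm_Stab // andbT.
  apply: contra_neq x1 => x1; apply: kperm_inj; rewrite x1; apply/(mulgI (kperm 1%g)).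
  by rewrite -kpermM !mulg1.
rewrite in_setD1 => /andP[t1 /kperm_surj[x xK tE]]; exists x => //.
rewrite in_setD1 xK andbT; apply: contra_neq t1 => x1.
by rewrite tE x1; apply/(mulgI (kperm 1%g)); rewrite -kpermM !mulg1.
Qed.

Lemma kperm_supported x (g : 'M[k]_(n * n')) :
  supported (kperm x \o block_of p) (block_of p) g <->
  supported (kact x \o pblock) pblock g.
Proof.
by split=> gx a b /gx/eqP E; apply/eqP; move: E; rewrite /comp kpermE.
Qed.

Lemma Autgr_kact g : Autgr p g ->
  exists2 x, x \in setX (Stab q) (Stab q') & supported (kact x \o pblock) pblock g.
Proof.
move=> /(Autgr_Stab pP)[t /kperm_surj[x xK ->] gt]; exists x => //.
exact/kperm_supported.
Qed.

Lemma kact_Autgr x (g : 'M[k]_(n * n')) : x \in setX (Stab q) (Stab q') ->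
  g \in unitmx -> supported (kact x \o pblock) pblock g -> Autgr p g.
Proof.
move=> xK gU /kperm_supported; apply: Stab_Autgr => //; exact: kperm_Stab.
Qed.

Lemma prodGLP (g : 'M[k]_(n * n')) :
  prodGL q q' g <-> g \in unitmx /\ supported pblock pblock g.
Proof.
have E a b : (row (kidx a).1 q == row (kidx b).1 q) &&
    (row (kidx a).2 q' == row (kidx b).2 q') = (pblock a == pblock b).
  by rewrite xpair_eqE !block_of_eq.
split=> -[gU gs]; split=> // a b /gs; first by rewrite E => /eqP.
by rewrite E => ->.
Qed.

(** Row [a] is the basis vector at the lifted image of [a], so the matrix product follows the
    left-to-right product of permutations. *)
Definition kmx (x : {perm blk q} * {perm blk q'}) : 'M[k]_(n * n') :=
  \matrix_(a, b) (kidx b == (block_lift x.1 (kidx a).1, block_lift x.2 (kidx a).2))%:R.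

Lemma kmx1 : kmx 1%g = 1%:M.
Proof.
apply/matrixP => a b; rewrite !mxE !block_lift1 -surjective_pairing eq_sym.
by rewrite (inj_eq (can_inj (g := fun X => mxvec_index X.1 X.2) kidxK)).
Qed.

Lemma kmxM x y :
  x \in setX (Stab q) (Stab q') -> y \in setX (Stab q) (Stab q') ->
  kmx (x * y)%g = kmx x *m kmx y.
Proof.
case: x y => [x x'] [y y']; rewrite 2!in_setX => /andP[x1 x2] /andP[y1 y2].
apply/matrixP => a b; rewrite !mxE.
pose c := mxvec_index (block_lift x (kidx a).1) (block_lift x' (kidx a).2).
rewrite (bigD1 c) //= !mxE mxvec_indexK eqxx mul1r !block_liftM //.
rewrite big1 ?addr0 // => d dc.
rewrite !mxE; case: eqP => [dE|_]; last by rewrite mul0r.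
by case/eqP: dc; rewrite -(kidxK d) dE.
Qed.

Lemma kmx_unit x : x \in setX (Stab q) (Stab q') -> kmx x \in unitmx.
Proof.
move=> xK; apply: (proj1 (mulmx1_unit (B := kmx x^-1%g) _)).
by rewrite -kmxM ?mulgV ?kmx1 // (groupVr (G := setX_group (Stab_group qP) (Stab_group q'P))).
Qed.

Lemma kmx_supported x : x \in setX (Stab q) (Stab q') ->
  supported (kact x \o pblock) pblock (kmx x).
Proof.
case: x => x x'; rewrite in_setX => /andP[x1 x2] a b; rewrite mxE.
case: (kidx b =P _) => [bE _|_]; last by rewrite eqxx.
by rewrite /pblock bE /= !block_of_lift.
Qed.

End Kronecker.

(** * The semidirect product decomposition *)

Theorem theorem5p3 (k : fieldType) (n n' : nat)
    (q : 'M[k]_n) (q' : 'M[k]_n') :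
  qpm q -> qpm q' -> mult_indep q q' ->
  (* Stab(q (x) q') is isomorphic to Stab(q) x Stab(q') *)
  (Stab (qkron q q') \isog setX (Stab q) (Stab q'))%g /\
  (* Aut_gr(S_{q (x) q'}(V (x) V')) = (prod GL(V_B (x) V'_B')) x| H
     with H a subgroup isomorphic to Stab(q) x Stab(q') *)
  exists phi : {perm blk q} * {perm blk q'} -> 'M[k]_(n * n'),
    let K := setX (Stab q) (Stab q') in
    [/\ (forall x y, x \in K -> y \in K -> phi (x * y)%g = phi x *m phi y),
        (forall x y, x \in K -> y \in K -> phi x = phi y -> x = y),
        (forall x, x \in K -> Autgr (qkron q q') (phi x))
      & [/\ (forall g, prodGL q q' g -> Autgr (qkron q q') g),
        (forall g h, Autgr (qkron q q') g -> prodGL q q' h ->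
                     prodGL q q' (invmx g *m h *m g)),
        (forall x, x \in K -> prodGL q q' (phi x) -> x = 1%g)
      & (forall g, Autgr (qkron q q') g ->
           exists2 h, prodGL q q' h &
             (exists2 x, x \in K & g = h *m phi x))]].
Proof.
move=> qP q'P qq'; split; first exact: Stab_qkron_isog.
exists (@kmx _ _ _ q q') => K.
have KV x : x \in K -> x^-1%g \in K.
  exact: (groupVr (G := setX_group (Stab_group qP) (Stab_group q'P))).
have row_kmx x : x \in K ->
    forall a, exists2 b, kmx x a b != 0 & kact x (pblock q q' a) = pblock q q' b.
  move=> xK a; have [b xab] := unitmx_row_neq0 a (kmx_unit qP q'P xK).
  by exists b => //; apply: (kmx_supported xK xab).
have comp_supported (T S : eqType) (f : T -> S) u v (h : 'M[k]_(n * n')) :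
    supported u v h -> supported (f \o u) (f \o v) h.
  by move=> uvh a b /uvh /= ->.
split=> [x y|x y xK yK xy|x xK|]; first exact: kmxM.
- apply: kact_faithful => // a; have [b xab ->] := row_kmx x xK a.
  by rewrite xy in xab; rewrite -(kmx_supported yK xab).
- exact: kact_Autgr (kmx_unit qP q'P xK) (kmx_supported xK).
split=> [g /prodGLP[gU gs]|g h gA /prodGLP[hU hs]|x xK /prodGLP[_ xs]|g gA].
- apply: (@kact_Autgr _ _ _ _ _ _ _ _ 1%g) => //.
    exact: (group1 (setX_group (Stab_group qP) (Stab_group q'P))).
  by move=> a b /gs; rewrite /= kact1.
- have gU : g \in unitmx by case: gA.
  have [x xK gx] := Autgr_kact qP q'P qq' gA.
  apply/prodGLP; split; first by rewrite !unitmx_mul unitmx_inv gU hU.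
  (* The labels run from [pblock] to [kact x \o pblock] under [invmx g], stay there under [h], and
     return under [g]. *)
  apply: (supported_mul _ gx); apply: (supported_mul (supported_inv gU gx)).
  exact: comp_supported.
- apply: kact_faithful => // a; have [b /xs ab ->] := row_kmx x xK a.
  by rewrite kact1 ab.
have gU : g \in unitmx by case: gA.
have [x xK gx] := Autgr_kact qP q'P qq' gA.
(* The factor [kmx x^-1] undoes the block permutation [x] induced by [g], leaving a block diagonal
   matrix. *)
exists (g *m kmx x^-1%g); last first.
  exists x => //; rewrite -mulmxA -kmxM ?KV // mulVg kmx1 mulmx1 //.
apply/prodGLP; split; first by rewrite unitmx_mul gU kmx_unit ?KV.
have VK := kmx_supported (KV _ xK).
have gVx := comp_supported _ _ (kact x^-1%g) _ _ _ gx.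
by move=> a b /(supported_mul gVx VK) /=; rewrite -kactM mulgV kact1.
Qed.
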